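(* Let $S$ be an inverse semigroup. Then $S$ is ultra-rich right ample if and only if $S$ is a group. Likewise, $S$ is ultra-rich left ample if and only if $S$ is a group.
   Context: Semigroups are nonempty. For $x$ in an inverse semigroup, $x^{-1}$ denotes its unique inverse. For a subsemigroup $S$ of an inverse semigroup $T$, put $S'=\{s^{-1}\in T:s\in S\}$. $S$ is rich right ample in $T$ if $x^{-1}y\in S\cup S'$ for all $x,y\in S$, and rich left ample in $T$ if $xy^{-1}\in S\cup S'$ for all $x,y\in S$. $S$ is ultra-rich right ample in $T$ if it is rich right ample in $T$ and for all $x,y\in S$ there is exactly one $a\in S\cup S'$ with $x^{-1}y=x^{-1}xa$. $S$ is ultra-rich left ample in $T$ if it is rich left ample in $T$ and for all $x,y\in S$ there is exactly one $b\in S\cup S'$ with $xy^{-1}=byy^{-1}$. A semigroup is called ultra-rich right (left) ample if it is such in some inverse semigroup containing it as a subsemigroup. *)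

(* Defs.v *)
From HB Require Import structures.
From mathcomp Require Import all_boot fingroup.
From mathcomp Require Import boolp classical_sets.

Set Implicit Arguments.
Unset Strict Implicit.
Unset Printing Implicit Defensive.

Local Open Scope group_scope.
Local Open Scope classical_set_scope.

Definition inverse_of (T : semigroupType) (x y : T) : Prop :=
  x * y * x = x /\ y * x * y = y.

(* The library operation [^-1] lives on [baseGroupType], which presupposes a
   unit element, so inverse semigroups get their own inversion. *)
HB.mixin Record isInverseSemigroup T of Semigroup T := {
  invs : T -> T;
  inverse_semigroup_inhabited : inhabited T;
  invsP : forall x : T, inverse_of x (invs x);
  invs_uniq : forall x y : T, inverse_of x y -> y = invs x
}.

#[short(type="inverseSemigroupType")]
HB.structure Definition InverseSemigroup :=
  { T of isInverseSemigroup T & Semigroup T }.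

Local Notation "x ^-1" := (invs x) : group_scope.

Definition subsemigroup (T : semigroupType) (S : set T) : Prop :=
  S !=set0 /\ forall x y, S x -> S y -> S (x * y).

Definition is_group (S : semigroupType) : Prop :=
  exists e : S, (forall x, e * x = x /\ x * e = x) /\
    forall x, exists y, y * x = e /\ x * y = e.

Section AmpleIn.
Variables (T : inverseSemigroupType) (S : set T).

Definition inverses : set T := [set s^-1 | s in S].

Definition rich_right_ample_in : Prop :=
  forall x y, S x -> S y -> (S `|` inverses) (x^-1 * y).

Definition rich_left_ample_in : Prop :=
  forall x y, S x -> S y -> (S `|` inverses) (x * y^-1).

Definition ultra_rich_right_ample_in : Prop :=
  rich_right_ample_in /\
  forall x y, S x -> S y ->
    exists! a, (S `|` inverses) a /\ x^-1 * y = x^-1 * x * a.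

Definition ultra_rich_left_ample_in : Prop :=
  rich_left_ample_in /\
  forall x y, S x -> S y ->
    exists! b, (S `|` inverses) b /\ x * y^-1 = b * y * y^-1.

End AmpleIn.

(* An abstract semigroup is contained in [T] by way of an injective
   multiplicative map, its copy in [T] being the range of that map. *)
Definition ultra_rich_right_ample (S : semigroupType) : Prop :=
  exists (T : inverseSemigroupType) (f : {multiplicative S -> T}),
    [/\ injective f, subsemigroup (range f)
      & ultra_rich_right_ample_in (range f)].

Definition ultra_rich_left_ample (S : semigroupType) : Prop :=
  exists (T : inverseSemigroupType) (f : {multiplicative S -> T}),
    [/\ injective f, subsemigroup (range f)
      & ultra_rich_left_ample_in (range f)].

(* Main.v *)
Require Import Defs.
From mathcomp Require Import all_boot fingroup.
From mathcomp Require Import classical_sets.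

Set Implicit Arguments.
Unset Strict Implicit.
Unset Printing Implicit Defensive.

Local Open Scope group_scope.
Local Open Scope classical_set_scope.

(** In [x^-1 * y = x^-1 * x * a], replace [y] by [x * y].  The equation becomes
    [x^-1 * x * y = x^-1 * x * a], and both [y] and [x^-1 * x * y] solve it,
    because [x^-1 * x] is idempotent.  In an inverse semigroup [S] both
    candidates lie in [S], so uniqueness makes every [x^-1 * x] a left identity
    ([ultra_rich_right_ample_left_id]).  Left identities of an inverse semigroup
    are inverse to each other as well as to themselves, hence all equal; so
    [x^-1 * x = x * x^-1] is one and the same element for all [x], and it is
    a two-sided identity ([left_id_group]).  The left ample case is dual.

    Conversely, a group is ultra-rich in itself: [x^-1 * x] is the identity, so
    the equation reads [x^-1 * y = a]. *)

Section InverseSemigroup.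
Variable S : inverseSemigroupType.
Implicit Types x y e : S.

Lemma mulsVs x : x * invs x * x = x.
Proof. by case: (invsP x). Qed.

Lemma invsK x : invs (invs x) = x.
Proof. by apply/esym/invs_uniq; case: (invsP x). Qed.

(** The two elements are inverse to each other and each is its own inverse, so
    uniqueness of inverses applies. *)
Lemma left_id_inj e e' : (forall x, e * x = x) -> (forall x, e' * x = x) ->
  e = e'.
Proof.
move=> idl idl'.
have -> : e = invs e by apply: invs_uniq; split; rewrite !idl.
by apply/esym/invs_uniq; split; rewrite ?idl ?idl' ?idl.
Qed.

Lemma right_id_inj e e' : (forall x, x * e = x) -> (forall x, x * e' = x) ->
  e = e'.
Proof.
move=> idr idr'.
have -> : e = invs e by apply: invs_uniq; split; rewrite !idr.
by apply/esym/invs_uniq; split; rewrite ?idr ?idr' ?idr.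
Qed.

Lemma invs_id_group e :
  (forall x, invs x * x = e) -> (forall x, x * invs x = e) -> is_group S.
Proof.
move=> mulVs mulsV; exists e; split=> x; last by exists (invs x).
by split; [rewrite -(mulsV x) | rewrite -(mulVs x) mulgA]; rewrite mulsVs.
Qed.

(** Applying the hypothesis to inverses shows that the elements [x * invs x] are
    left identities too, which is what merges them with the [invs x * x]. *)
Lemma left_id_group : (forall x y, invs x * x * y = y) -> is_group S.
Proof.
move=> idl; have [x0] := @inverse_semigroup_inhabited S.
apply: (@invs_id_group (invs x0 * x0)) => x; apply: left_id_inj => y //.
by rewrite -{1}(invsK x).
Qed.

Lemma right_id_group : (forall x y, y * (x * invs x) = y) -> is_group S.
Proof.
move=> idr; have [x0] := @inverse_semigroup_inhabited S.
apply: (@invs_id_group (x0 * invs x0)) => x; apply: right_id_inj => y //.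
by rewrite -{2}(invsK x).
Qed.

(** For the pair [x], [x * y], the images in [T] of [y] and of [invs x * x * y]
    are competing solutions, and the embedding is injective. *)
Lemma ultra_rich_right_ample_left_id :
  ultra_rich_right_ample S -> forall x y, invs x * x * y = y.
Proof.
move=> [T [f [f_inj _ [_ ura]]]] x y; apply: f_inj.
have [a [_ a_uniq]] := ura (f x) (f (x * y)) (imageT f _) (imageT f _).
have <- : a = f y.
  by apply: a_uniq; split; [left; exact: imageT | rewrite gmulfM mulgA].
apply/esym/a_uniq; split; first by left; exact: imageT.
by rewrite -mulgA -gmulfM !mulgA mulsVs.
Qed.

(** Dually, for the pair [y * x], [x] the competing solutions are the images of
    [y] and of [y * (x * invs x)]. *)
Lemma ultra_rich_left_ample_right_id :
  ultra_rich_left_ample S -> forall x y, y * (x * invs x) = y.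
Proof.
move=> [T [f [f_inj _ [_ ula]]]] x y; apply: f_inj.
have [b [_ b_uniq]] := ula (f (y * x)) (f x) (imageT f _) (imageT f _).
have <- : b = f y.
  by apply: b_uniq; split; [left; exact: imageT | rewrite gmulfM].
apply/esym/b_uniq; split; first by left; exact: imageT.
by rewrite -gmulfM -!mulgA (mulgA x) mulsVs.
Qed.

Lemma group_invs : is_group S ->
  exists e, [/\ forall x, e * x = x, forall x, x * e = x,
                forall x, invs x * x = e & forall x, x * invs x = e].
Proof.
move=> [e [ide inve]].
have idl x : e * x = x by case: (ide x).
have idr x : x * e = x by case: (ide x).
have invE x : invs x * x = e /\ x * invs x = e.
  have [y [yx xy]] := inve x.
  suff <- : y = invs x by [].
  by apply: invs_uniq; split; rewrite ?xy ?yx idl.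
by exists e; split=> // x; case: (invE x).
Qed.

Lemma subsemigroup_range_id : subsemigroup (range (@idfun S)).
Proof.
split; last by move=> x y _ _; exists (x * y).
by have [x] := @inverse_semigroup_inhabited S; exists x, x.
Qed.

Lemma group_ultra_rich_right_ample : is_group S -> ultra_rich_right_ample S.
Proof.
move=> /group_invs[e [idl _ mulVs _]]; exists S, idfun.
split=> //; first exact: subsemigroup_range_id.
split=> x y _ _; first by left; exists (invs x * y).
exists (invs x * y); split=> [|a [_ ->]]; last by rewrite mulVs idl.
by rewrite mulVs idl; split=> //; left; exists (invs x * y).
Qed.

Lemma group_ultra_rich_left_ample : is_group S -> ultra_rich_left_ample S.
Proof.
move=> /group_invs[e [_ idr _ mulsV]]; exists S, idfun.
split=> //; first exact: subsemigroup_range_id.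
split=> x y _ _; first by left; exists (x * invs y).
exists (x * invs y); split=> [|b [_ ->]]; last by rewrite -mulgA mulsV idr.
by rewrite -mulgA mulsV idr; split=> //; left; exists (x * invs y).
Qed.

End InverseSemigroup.

Theorem corollary5p3 (S : inverseSemigroupType) :
  (ultra_rich_right_ample S <-> is_group S) /\
  (ultra_rich_left_ample S <-> is_group S).
Proof.
split; split.
- by move=> /ultra_rich_right_ample_left_id; exact: left_id_group.
- exact: group_ultra_rich_right_ample.
- by move=> /ultra_rich_left_ample_right_id; exact: right_id_group.
- exact: group_ultra_rich_left_ample.
Qed.
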